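(* Let $V_h$ be a discrete space and let $\phi$ be an N-function. For $v_h\in V_h$ and $\tau\in L^1(\Omega;\mathbb{R}^d)$ let $$\mathcal{J}(v_h)=\int_\Omega \phi(|\nabla_h v_h|)\,dx-\int_\Omega f v_h\,dx,\qquad \mathcal{J}^*(\tau)=\int_\Omega \phi^*(|\tau|)\,dx .$$ Let $u_h\in V_h$ denote the discrete minimizer $u_h=\operatorname*{arg\,min}_{v_h\in V_h}\mathcal{J}(v_h)$. Moreover, let $\tau\in L^1(\Omega;\mathbb{R}^d)$ with $-\operatorname{div}_h\tau=f$ in $V_h^*$ be given. Then one has the computable guaranteed upper bound $$\mathcal{J}(v_h)-\mathcal{J}(u_h)\le\mathcal{J}(v_h)+\mathcal{J}^*(\tau)\qquad\text{for all }v_h\in V_h .$$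
   Context: $\Omega\subset\mathbb{R}^d$ is a bounded Lipschitz domain and $\mathcal{T}$ is a regular triangulation of $\Omega$. $\mathbb{P}_k(\mathcal{T})$ denotes the functions in $L^1(\Omega)$ whose restriction to each $T\in\mathcal{T}$ is a polynomial of degree at most $k$. The broken gradient $\nabla_h$ is defined by $(\nabla_h v)|_T:=\nabla (v|_T)$ for all $T\in\mathcal{T}$. Discrete space: $V_h$ is a finite-dimensional (finite element) space such as (i) the Lagrange space $\mathcal{L}^1_{k,0}(\mathcal{T})=\mathbb{P}_k(\mathcal{T})\cap W^{1,1}_0(\Omega)$ of order $k\in\mathbb{N}$; (ii) the Crouzeix–Raviart space $\mathrm{CR}^1_0(\mathcal{T})$ of all $v_h\in\mathbb{P}_1(\mathcal{T})$ that are continuous at the midpoints of interior faces of $\mathcal{T}$ and vanish at the barycenters of faces on $\partial\Omega$; (iii) spaces of discretely divergence-free functions, such as the Taylor–Hood element $\{v_h\in\mathcal{L}^1_{2,0}(\mathcal{T})^d:\int_\Omega p_h\operatorname{div}v_h\,dx=0$ for all continuous $p_h\in\mathbb{P}_1(\mathcal{T})\}$, the Crouzeix–Raviart element $\{v_h\in\mathrm{CR}^1_0(\mathcal{T})^d:\sum_{T\in\mathcal{T}}\int_T p_h\operatorname{div}v_h\,dx=0$ for all $p_h\in\mathbb{P}_0(\mathcal{T})\}$, or, for $d=2$, the Kouhia–Stenberg element, defined as the preceding one with $\mathrm{CR}^1_0(\mathcal{T})^d$ replaced by $\mathcal{L}^1_{1,0}(\mathcal{T})\times\mathrm{CR}^1_0(\mathcal{T})$.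 The notation is the one for scalar-valued functions; for vector-valued spaces $\mathbb{R}^d$ is replaced by $\mathbb{R}^{d\times d}$. Right-hand side: $f$ is a given right-hand side; for rough functionals $f$ the integral $\int_\Omega f v_h\,dx$ is replaced by the duality pairing. N-function: $\phi:\mathbb{R}_{\ge0}\to\mathbb{R}_{\ge0}$ is an N-function if it is continuous and convex and there is a right-continuous, non-decreasing function $\phi':\mathbb{R}_{\ge0}\to\mathbb{R}_{\ge0}$ with $\phi(t)=\int_0^t\phi'(s)\,ds$, $\lim_{t\to\infty}\phi'(t)=\infty$, $\phi'(0)=0$, and $\phi'(t)>0$ for all $t>0$. Its convex conjugate is $\phi^*(r):=\sup_{s\ge0}(rs-\phi(s))$ for $r\ge0$. For $\tau\in L^1(\Omega;\mathbb{R}^d)$, ''$-\operatorname{div}_h\tau=f$ in $V_h^*$'' means $\int_\Omega\tau\cdot\nabla_h v_h\,dx=\int_\Omega f v_h\,dx$ for all $v_h\in V_h$. *)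

(* Defs.v *)
From HB Require Import structures.
From mathcomp Require Import all_boot all_order all_algebra.
From mathcomp Require Import all_classical all_reals all_analysis.
From mathcomp Require Import lra.

Set Implicit Arguments.
Unset Strict Implicit.
Unset Printing Implicit Defensive.

Import Order.TTheory GRing.Theory Num.Theory.
Import numFieldNormedType.Exports.

Local Open Scope classical_set_scope.
Local Open Scope ring_scope.

(* The sigma-algebra on R^n is generated by the coordinates, as the library does
   for tuples. It is the Borel sigma-algebra, see [open_measurable_rV]. *)
Section rV_measurable.
Context {R : realType} {n : nat}.

Let coors : 'I_n -> 'rV[R]_n -> R := fun i x => x 0 i.

Let rV_set0 : g_sigma_preimage coors set0.
Proof. exact: sigma_algebra0. Qed.

Let rV_setC A : g_sigma_preimage coors A -> g_sigma_preimage coors (~` A).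
Proof. exact: sigma_algebraC. Qed.

Let rV_bigcup (F : _^nat) : (forall i, g_sigma_preimage coors (F i)) ->
  g_sigma_preimage coors (\bigcup_i (F i)).
Proof. exact: sigma_algebra_bigcup. Qed.

HB.instance Definition _ := @isMeasurable.Build default_measure_display
  'rV[R]_n (g_sigma_preimage coors) rV_set0 rV_setC rV_bigcup.

Lemma measurable_coord (i : 'I_n) :
  measurable_fun [set: 'rV[R]_n] (fun x : 'rV[R]_n => x 0 i).
Proof.
move=> _ Y mY; rewrite setTI; apply: sub_sigma_algebra => /=.
rewrite -bigcup_seq/=; exists i => /=; first by rewrite mem_index_enum.
by exists Y => //; rewrite setTI.
Qed.

Lemma measurable_fun_rVP d (T : measurableType d) (f : T -> 'rV[R]_n) :
  (forall i, measurable_fun [set: T] (fun t => f t 0 i)) <->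
  measurable_fun [set: T] f.
Proof.
split=> [mf|mf i]; last first.
  by apply: (measurableT_comp (measurable_coord i)).
move=> _ A mA; rewrite setTI.
pose G := [set B : set 'rV[R]_n | measurable (f @^-1` B)].
suff sG : (measurable : set (set 'rV[R]_n)) `<=` G by exact: (sG A mA).
apply: smallest_sub.
  split => /=.
  - by rewrite /G/= preimage_set0.
  - by move=> B GB; rewrite /G/= setTD preimage_setC; exact: measurableC.
  - by move=> F GF; rewrite /G/= preimage_bigcup; apply: bigcupT_measurable.
rewrite -bigcup_seq => B [i _ [C mC <-]].
rewrite /G/= setTI -comp_preimage.
by have := mf i measurableT C mC; rewrite setTI.
Qed.

End rV_measurable.


(* n-dimensional Lebesgue measure is the n-fold product of [lebesgue_measure],
   transported along R * R^n -> R^(n+1); it is characterized by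
   [lebesgue_rV_box]. *)
Section lebesgue_rV.
Context {R : realType}.

Definition cons_rV n (p : measurableTypeR R * 'rV[R]_n) : 'rV[R]_n.+1 :=
  \row_i oapp (p.2 0) p.1 (unlift ord0 i).

Lemma cons_rV_ord0 n (p : measurableTypeR R * 'rV[R]_n) : cons_rV p 0 ord0 = p.1.
Proof. by rewrite mxE unlift_none. Qed.

Lemma cons_rV_lift n (p : measurableTypeR R * 'rV[R]_n) j : cons_rV p 0 (lift ord0 j) = p.2 0 j.
Proof. by rewrite mxE liftK. Qed.

Lemma measurable_cons_rV n : measurable_fun [set: measurableTypeR R * 'rV[R]_n] (@cons_rV n).
Proof.
apply/measurable_fun_rVP => i; case: (unliftP ord0 i) => [j ->|->].
  under eq_fun do rewrite cons_rV_lift.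
  exact: (measurableT_comp (measurable_coord j)).
under eq_fun do rewrite cons_rV_ord0.
exact: measurable_fst.
Qed.

Section step.
Variables (n : nat) (m : {sigma_finite_measure set 'rV[R]_n -> \bar R}).

Definition lebesgue_rV_step : set 'rV[R]_n.+1 -> \bar R :=
  pushforward (lebesgue_measure \x m)%E (@cons_rV n).

Let step0 : lebesgue_rV_step set0 = 0%E.
Proof. by rewrite /lebesgue_rV_step /pushforward preimage_set0 measure0. Qed.

Let step_ge0 A : (0 <= lebesgue_rV_step A)%E.
Proof. by rewrite /lebesgue_rV_step /pushforward measure_ge0. Qed.

Let step_sigma_additive : semi_sigma_additive lebesgue_rV_step.
Proof.
have mf := @measurable_cons_rV n.
move=> F mF tF mUF; rewrite /lebesgue_rV_step /pushforward preimage_bigcup.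
apply: measure_semi_sigma_additive.
- by move=> i; rewrite -[X in measurable X]setTI; exact: mf.
- apply/trivIsetP => /= i j _ _ ij; rewrite -preimage_setI.
  by move/trivIsetP : tF => /(_ _ _ _ _ ij) ->//; rewrite preimage_set0.
- by rewrite -preimage_bigcup -[X in measurable X]setTI; exact: mf.
Qed.

HB.instance Definition _ := isMeasure.Build _ _ _
  lebesgue_rV_step step0 step_ge0 step_sigma_additive.

Let step_sigma_finite : sigma_finite setT lebesgue_rV_step.
Proof.
have [F TF mF] : sigma_finite setT (lebesgue_measure \x m)%E.
  have /sigma_finiteP[F [TF ndF Foo]] :=
    sigma_finiteT (@lebesgue_measure R : {sigma_finite_measure set _ -> \bar R}).
  have /sigma_finiteP[G [TG ndG Goo]] := sigma_finiteT m.
  exists (fun i => F i `*` G i) => [|k].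
    rewrite -setXTT TF TG predeqE => -[x y]; split.
      move=> [/= [i _ Fix] [k _ Gky]]; exists (maxn i k) => //; split.
      - by move: x Fix; exact/subsetPset/ndF/leq_maxl.
      - by move: y Gky; exact/subsetPset/ndG/leq_maxr.
    by move=> [i _ []/= ? ?]; split; exists i.
  have [? ?] := Foo k; have [? ?] := Goo k.
  split; first exact: measurableX.
  by rewrite product_measure1E// lte_mul_pinfty// ge0_fin_numE.
pose g (x : 'rV[R]_n.+1) : measurableTypeR R * 'rV[R]_n :=
  (x 0 ord0, \row_j x 0 (lift ord0 j)).
have mg : measurable_fun setT g.
  apply: measurable_fun_pair => /=; first exact: measurable_coord.
  apply/measurable_fun_rVP => i; under eq_fun do rewrite mxE.
  exact: measurable_coord.
have gK p : g (cons_rV p) = p.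
  rewrite /g cons_rV_ord0 [RHS]surjective_pairing; congr (_, _).
  by apply/rowP => j; rewrite mxE cons_rV_lift.
exists (fun i => g @^-1` F i) => [|i].
  by rewrite -preimage_bigcup -TF preimage_setT.
have [mFi Fioo] := mF i; split.
  by rewrite -[X in measurable X]setTI; exact: mg.
rewrite /lebesgue_rV_step /pushforward -comp_preimage (_ : g \o _ = id)//.
by apply/funext => p /=; rewrite gK.
Qed.

HB.instance Definition _ :=
  @Measure_isSigmaFinite.Build _ _ _ lebesgue_rV_step step_sigma_finite.

Definition lebesgue_rV_succ : {sigma_finite_measure set 'rV[R]_n.+1 -> \bar R} :=
  lebesgue_rV_step.
End step.

Definition lebesgue_rV0 : {sigma_finite_measure set 'rV[R]_0 -> \bar R} :=
  \d_(0 : 'rV[R]_0).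

Fixpoint lebesgue_rV n : {sigma_finite_measure set 'rV[R]_n -> \bar R} :=
  if n is n'.+1 then lebesgue_rV_succ (lebesgue_rV n') else lebesgue_rV0.
End lebesgue_rV.

Lemma measurable_box (R : realType) n (A : 'I_n -> set R) :
  (forall i, measurable (A i)) ->
  measurable [set x : 'rV[R]_n | forall i, A i (x 0 i)].
Proof.
move=> mA.
rewrite (_ : mkset _ = \big[setI/setT]_(i < n) ((fun x : 'rV[R]_n => x 0 i) @^-1` A i)).
  apply: bigsetI_measurable => i _.
  by rewrite -[X in measurable X]setTI; exact: measurable_coord.
rewrite -bigcap_seq; apply/seteqP; split => x /= h i; first by move=> _; exact: h.
by apply: h; rewrite /= mem_index_enum.
Qed.

Lemma lebesgue_rV_box (R : realType) n (A : 'I_n -> set R) :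
  (forall i, measurable (A i)) ->
  lebesgue_rV n [set x | forall i, A i (x 0 i)] =
  (\prod_(i < n) lebesgue_measure (A i))%E.
Proof.
elim: n A => [|n IH] A mA.
  rewrite big_ord0 /= /dirac/= indicE mem_set// => -[].
  by [].
have mB : measurable [set y : 'rV[R]_n | forall i, A (lift ord0 i) (y 0 i)].
  by apply: (@measurable_box R n (fun i => A (lift ord0 i))) => i; exact: mA.
have mA0 := mA ord0.
rewrite big_ord_recl -IH -?[RHS]product_measure1E//.
rewrite [LHS]/= /lebesgue_rV_step /pushforward; congr (product_measure1 _ _ _).
apply/seteqP; split => [[x y]/= h|[x y]/= [h1 h2] i].
  split=> [|i]; first by have := h ord0; rewrite cons_rV_ord0.
  by have := h (lift ord0 i); rewrite cons_rV_lift.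
by case: (unliftP ord0 i) => [j ->|->]; rewrite ?cons_rV_lift ?cons_rV_ord0.
Qed.

Lemma open_measurable_rV (R : realType) n (A : set 'rV[R]_n) :
  open A -> measurable A.
Proof.
move=> oA.
pose B (q : 'rV[rat]_n * nat) : set 'rV[R]_n :=
  [set x | forall i, `](ratr (q.1 0 i) - q.2.+1%:R^-1), (ratr (q.1 0 i) + q.2.+1%:R^-1)[%classic (x 0 i)].
have -> : A = \bigcup_(q in [set q | B q `<=` A]) B q.
  apply/seteqP; split => [x Ax|x [q /= BqA]]; last exact: BqA.
  have /nbhs_ballP[e /= e0 xeA] : nbhs x A by exact: open_nbhs_nbhs.
  have [k ke] : exists k : nat, k.+1%:R^-1 * 2 < e.
    have [k] := ltr_add_invr (divr_gt0 e0 (ltr0n R 2)).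
    by rewrite add0r ltr_pdivlMr//; exists k.
  have rq i : exists q : rat, `|ratr q - x 0 i| < k.+1%:R^-1.
    have xk : x 0 i - k.+1%:R^-1 < x 0 i + k.+1%:R^-1.
      by rewrite ltrBlDr -addrA ltrDl addr_gt0.
    by have [q] := rat_in_itvoo xk; rewrite in_itv/= -ltr_distl; exists q.
  have [q hq] := choice rq.
  exists (\row_i q i, k); last first.
    by move=> i /=; rewrite mxE in_itv/=; have := hq i; rewrite ltr_distlC.
  move=> y /= By; apply: xeA; split=> [|i j]; first exact: e0.
  rewrite !ord1.
  have := hq j; have := By j; rewrite /= mxE in_itv/= /ball/= !ltr_distlC.
  move=> /andP[h1 h2] /andP[h3 h4].
  have aux (a t u v : R) : t * 2 < e -> a - t < v -> v < a + t -> a - t < u ->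
    u < a + t -> u - e < v < u + e by lra.
  exact: aux ke h1 h2 h3 h4.
rewrite bigcup_mkcond; apply: countable_bigcupT_measurable => [|q].
  exact: countableP.
case: ifPn => // _.
exact: (@measurable_box R n (fun i => `](ratr (q.1 0 i) - q.2.+1%:R^-1),
  (ratr (q.1 0 i) + q.2.+1%:R^-1)[%classic)).
Qed.

Section domain.
Context {R : realType} {d : nat}.
Implicit Types (Omega : set 'rV[R]_d).

Definition mxdot m n (A B : 'M[R]_(m, n)) : R := \sum_i \sum_j A i j * B i j.

Definition frobenius m n (A : 'M[R]_(m, n)) : R := Num.sqrt (mxdot A A).

(* Near each boundary point x, Omega is the part above the graph of a Lipschitz
   function in the direction e; [y - mxdot y e *: e] is the projection of y on
   the hyperplane orthogonal to e. *)
Definition lipschitz_boundary Omega :=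
  forall x, closure Omega x -> ~ Omega x ->
  exists (e : 'rV[R]_d) (g : 'rV[R]_d -> R^o),
    [/\ frobenius e = 1, [lipschitz g y | y in setT] &
     \forall y \near x,
       Omega y <-> g (y - mxdot y e *: e) < mxdot y e].

Definition bounded_lipschitz_domain Omega :=
  [/\ Omega !=set0, open Omega, connected Omega, bounded_set Omega &
   lipschitz_boundary Omega].

(* The rows of P are the d+1 vertices, and [face P S] is the convex hull of the
   vertices with index in S. *)
Definition face (P : 'M[R]_(d.+1, d)) (S : {set 'I_d.+1}) : set 'rV[R]_d :=
  [set w *m P | w in [set w : 'rV[R]_d.+1 |
    [/\ forall i, 0 <= w 0 i, \sum_i w 0 i = 1 &
     forall i, i \notin S -> w 0 i = 0]]].

Definition simplex P := face P [set: 'I_d.+1]%SET.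

Definition nondegenerate (P : 'M[R]_(d.+1, d)) :=
  \matrix_(i < d) (row (lift ord0 i) P - row ord0 P) \in unitmx.

(* Two distinct elements meet in a common proper face, possibly the empty one
   (S = set0). *)
Definition regular_triangulation Omega N (T : 'I_N -> 'M[R]_(d.+1, d)) :=
  [/\ forall i, nondegenerate (T i),
      closure Omega = \bigcup_i simplex (T i) &
      forall i j, i != j -> exists Si Sj : {set 'I_d.+1},
        [/\ Si != [set: 'I_d.+1]%SET, Sj != [set: 'I_d.+1]%SET,
            simplex (T i) `&` simplex (T j) = face (T i) Si &
            simplex (T i) `&` simplex (T j) = face (T j) Sj]].

Definition L1_mx Omega m n (tau : 'rV[R]_d -> 'M[R]_(m, n)) :=
  forall i j, (lebesgue_rV d).-integrable Omega (fun x => (tau x i j)%:E).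

Definition poly_fun (k : nat) (q : 'rV[R]_d -> R) :=
  exists c : {ffun 'I_d -> 'I_k.+1} -> R, forall x,
    q x = \sum_(a : {ffun 'I_d -> 'I_k.+1} | (\sum_i a i <= k)%N)
            c a * \prod_i x 0 i ^+ a i.

(* Elements of L^1(Omega) are represented by functions. [v] is polynomial on the
   interior of each T, because its values on the element boundaries, which form
   a null set, are immaterial. *)
Definition piecewise_poly Omega N (T : 'I_N -> 'M[R]_(d.+1, d)) m k
    (v : 'rV[R]_d -> 'rV[R]_m) :=
  L1_mx Omega v /\
  forall t (j : 'I_m), exists2 q, poly_fun k q &
    forall x, interior (simplex (T t)) x -> v x 0 j = q x.

(* [jacobian] acts on row vectors, hence the transpose: row i is the gradient of
   the i-th component of v. The value 0 on the element boundaries is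
   conventional. *)
Definition broken_grad N (T : 'I_N -> 'M[R]_(d.+1, d)) m
    (v : 'rV[R]_d -> 'rV[R]_m) (x : 'rV[R]_d) : 'M[R]_(m, d) :=
  if x \in \bigcup_t interior (simplex (T t)) then (jacobian v x)^T else 0.

(* A finite-dimensional subspace of L^1(Omega) of R^m-valued piecewise
   polynomials; m = 1 is the scalar case and m = d the vector-valued one. This
   covers the Lagrange, Crouzeix-Raviart, Taylor-Hood and Kouhia-Stenberg spaces
   together with their discretely divergence-free subspaces. *)
Definition discrete_space Omega N (T : 'I_N -> 'M[R]_(d.+1, d)) m
    (V : set ('rV[R]_d -> 'rV[R]_m)) :=
  [/\ exists k, V `<=` piecewise_poly Omega T k,
      V (cst 0),
      forall (a : R) u v, V u -> V v -> V (fun x => a *: u x + v x) &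
      exists n (b : 'I_n -> 'rV[R]_d -> 'rV[R]_m),
        (forall i, V (b i)) /\
        forall v, V v -> exists c : 'I_n -> R,
          {ae lebesgue_rV d, forall x, Omega x ->
            v x = \sum_i c i *: b i x}].

(* A right-hand side is a linear functional on V, which covers the duality
   pairing; for f given by a function see [linear_on_load]. *)
Definition linear_on m (V : set ('rV[R]_d -> 'rV[R]_m))
    (F : ('rV[R]_d -> 'rV[R]_m) -> R) :=
  forall a u v, V u -> V v -> F (fun x => a *: u x + v x) = a * F u + F v.

Definition load Omega m (f v : 'rV[R]_d -> 'rV[R]_m) : R :=
  Rintegral (lebesgue_rV d) Omega (fun x => mxdot (f x) (v x)).

Lemma linear_on_load Omega m (V : set ('rV[R]_d -> 'rV[R]_m)) f :
  open Omega ->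
  (forall v, V v ->
    (lebesgue_rV d).-integrable Omega (fun x => (mxdot (f x) (v x))%:E)) ->
  linear_on V (load Omega f).
Proof.
move=> /open_measurable_rV mO fV a u v Vu Vv.
rewrite /load -RintegralZl//; last exact: fV.
rewrite -RintegralD//; [|exact: (integrableZl mO a (fV u Vu))|exact: fV].
congr Rintegral; apply/funext => x; rewrite /mxdot/= mulr_sumr -big_split/=.
apply: eq_bigr => i _; rewrite mulr_sumr -big_split/=.
by apply: eq_bigr => j _; rewrite !mxE mulrDr mulrCA.
Qed.

End domain.

Section N_function.
Context {R : realType}.

Definition N_function (phi : R -> R) :=
  [/\ forall t, 0 <= t -> 0 <= phi t,
      {within `[0, +oo[, continuous phi},
      @convex_function R R^o `[0, +oo[%classic phi &
      exists dphi : R -> R,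
        [/\ (forall t, 0 <= t -> 0 <= dphi t) /\
             {in `[0, +oo[ &, {homo dphi : s t / s <= t}},
             (forall t, 0 <= t -> dphi s @[s --> t^'+] --> dphi t),
             (forall t, 0 <= t -> (phi t)%:E =
               (\int[lebesgue_measure]_(s in `[0%R, t]) (dphi s)%:E)%E),
             dphi t @[t --> +oo] --> +oo &
             dphi 0 = 0 /\ (forall t, 0 < t -> 0 < dphi t)]].

Definition conjugate (phi : R -> R) (r : R) : \bar R :=
  ereal_sup [set (r * s - phi s)%:E | s in `[0, +oo[ ].

End N_function.

Section energies.
Context {R : realType} {d m : nat}.
Variables (Omega : set 'rV[R]_d) (phi : R -> R).
Local Open Scope ereal_scope.

(* [energy] is finite on a discrete space, whereas [dual_energy] may be +oo. *)
Definition energy N (T : 'I_N -> 'M[R]_(d.+1, d))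
    (f : ('rV[R]_d -> 'rV[R]_m) -> R) (v : 'rV[R]_d -> 'rV[R]_m) : \bar R :=
  \int[lebesgue_rV d]_(x in Omega) (phi (frobenius (broken_grad T v x)))%:E
  - (f v)%:E.

Definition dual_energy (tau : 'rV[R]_d -> 'M[R]_(m, d)) : \bar R :=
  \int[lebesgue_rV d]_(x in Omega) conjugate phi (frobenius (tau x)).

Definition neg_broken_div_eq N (T : 'I_N -> 'M[R]_(d.+1, d))
    (V : set ('rV[R]_d -> 'rV[R]_m)) tau f :=
  forall v, V v ->
  \int[lebesgue_rV d]_(x in Omega) (mxdot (tau x) (broken_grad T v x))%:E
  = (f v)%:E.

End energies.

(* Main.v *)
(* At each point x of Omega, Cauchy-Schwarz and the Fenchel-Young inequality
   give tau . grad u_h <= phi (|grad u_h|) + phi^* (|tau|). Integrating and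
   testing the equation for tau with u_h turns this into weak duality,
   - J(u_h) <= J^*(tau), and it remains to add J(v_h) on both sides.
   The gradient term needs no measurability: the library integral of a
   nonnegative function is a lower integral, which is subadditive as soon as one
   of the two summands is measurable. *)
Require Import Defs.
From mathcomp Require Import all_boot all_order all_algebra.
From mathcomp Require Import all_classical all_reals all_analysis.
From mathcomp Require Import measurable_realfun ring lra.

Import Order.TTheory GRing.Theory Num.Theory.
Import numFieldNormedType.Exports.

Local Open Scope classical_set_scope.
Local Open Scope ring_scope.

Section lower_integral.
Local Open Scope ereal_scope.
Context d (T : measurableType d) (R : realType).
Variable mu : {measure set T -> \bar R}.

Import HBNNSimple.

(** The integral of a nonnegative function is a supremum over the simple functions below it, and
    those below [f] are also below [g]. *)
Lemma ge0_le_lower_integral (D : set T) (f g : T -> \bar R) :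
  (forall x, D x -> 0 <= f x) -> (forall x, D x -> f x <= g x) ->
  \int[mu]_(x in D) f x <= \int[mu]_(x in D) g x.
Proof.
move=> f0 fg; have g0 x : D x -> 0 <= g x.
  by move=> Dx; exact: le_trans (f0 _ Dx) (fg _ Dx).
rewrite !ge0_integralE//; apply: ereal_sup_le => _ [h /= hf <-].
by exists h => // x; apply: le_trans (hf x) _; exact: lee_restrict.
Qed.

(** A simple [s] below [f] satisfies [s <= k + h] with [k] the positive part of [s - h]. Both [k]
    and [h] are measurable, so the integral of their sum splits, and [k <= g] pointwise. *)
Lemma le_lower_integralD_setT (f g h : T -> \bar R) :
  (forall x, 0 <= f x) -> (forall x, 0 <= g x) -> (forall x, 0 <= h x) ->
  measurable_fun [set: T] h -> (forall x, f x <= g x + h x) ->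
  \int[mu]_x f x <= \int[mu]_x g x + \int[mu]_x h x.
Proof.
move=> f0 g0 h0 mh fgh; rewrite [leLHS]ge0_integralTE//.
apply: ge_ereal_sup => _ [s /= sf <-]; rewrite -integralT_nnsfun.
pose k x := maxe ((s x)%:E - h x) 0.
have ms : measurable_fun [set: T] (EFin \o s) by exact/measurable_EFinP.
have mk : measurable_fun [set: T] k.
  apply: measurable_maxe; last exact: measurable_cst.
  exact: emeasurable_funB.
have k0 x : 0 <= k x by rewrite /k le_max lexx orbT.
apply: (@le_trans _ _ (\int[mu]_x (k x + h x))).
  apply: ge0_le_integral => //.
  - by move=> x _; rewrite lee_fin.
  - exact: emeasurable_funD.
  move=> x _; rewrite /k; have := h0 x; case: (h x) => [r| |]// r0; last first.
    (* Where [h] is [+oo], [k] is [0] and the sum [k + h] is still [+oo]. *)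
    by rewrite addey ?leey// gt_eqF// (lt_le_trans ltNy0)// le_max lexx orbT.
  by rewrite -leeBlDr// le_max lexx.
rewrite ge0_integralD//; apply: leeD => //; apply: ge0_le_lower_integral => //.
move=> x _; rewrite /k ge_max g0 andbT; have := le_trans (sf x) (fgh x).
by have := h0 x; case: (h x) => [r| |]// r0; [rewrite leeBlDr|rewrite leNye].
Qed.

Lemma le_lower_integralD (D : set T) (f g h : T -> \bar R) : measurable D ->
  (forall x, D x -> 0 <= g x) -> (forall x, D x -> 0 <= h x) ->
  measurable_fun D h -> (forall x, D x -> f x <= g x + h x) ->
  \int[mu]_(x in D) f x <= \int[mu]_(x in D) g x + \int[mu]_(x in D) h x.
Proof.
(* The sign of [f] is free: its integral is at most that of [f^\+], which [g + h >= 0] still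
   dominates. *)
move=> mD g0 h0 mh fgh; apply: (@le_trans _ _ (\int[mu]_(x in D) f^\+ x)).
  by rewrite integralE geeDl// oppe_le0 integral_ge0.
rewrite !(integral_mkcond D); apply: le_lower_integralD_setT.
- by move=> x; exact: erestrict_ge0.
- by move=> x; exact: erestrict_ge0.
- by move=> x; exact: erestrict_ge0.
- exact/(measurable_restrictT _ _).1.
move=> x; rewrite /patch; case: ifPn => [|_]; last by rewrite adde0.
by rewrite inE => Dx; rewrite funeposE ge_max fgh// adde_ge0 ?g0 ?h0.
Qed.

End lower_integral.

Section frobenius.
Context {R : realType} {m n : nat}.
Implicit Types A B : 'M[R]_(m, n).

Lemma mxdot_ge0 A : 0 <= mxdot A A.
Proof. by do 2!(apply: sumr_ge0 => ? _); rewrite -expr2 sqr_ge0. Qed.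

Lemma mxdot_lincomb (a b : R) A B :
  mxdot (a *: A + b *: B) (a *: A + b *: B) =
  a ^+ 2 * mxdot A A + a * b * 2 * mxdot A B + b ^+ 2 * mxdot B B.
Proof.
rewrite /mxdot !mulr_sumr -!big_split/=; apply: eq_bigr => i _.
rewrite !mulr_sumr -!big_split/=; apply: eq_bigr => j _.
by rewrite !mxE; ring.
Qed.

(** The quadratic form [(a, b) |-> |a A + b B|^2] is nonnegative; suitable values of [a] and [b]
    give the squared inequality. *)
Lemma mxdot_CauchySchwarz A B : mxdot A B <= frobenius A * frobenius B.
Proof.
have AA := mxdot_ge0 A; have BB := mxdot_ge0 B.
rewrite /frobenius -sqrtrM// (le_trans (ler_norm _))// -sqrtr_sqr ler_sqrt ?mulr_ge0//.
have q a b : 0 <= a ^+ 2 * mxdot A A + a * b * 2 * mxdot A B + b ^+ 2 * mxdot B B.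
  by rewrite -mxdot_lincomb mxdot_ge0.
have [B0|B0] := eqVneq (mxdot B B) 0; last first.
  have {}B0 : 0 < mxdot B B by rewrite lt_def B0.
  (* At this choice the form equals [B.B * (A.A * B.B - (A.B)^2)]. *)
  rewrite -(ler_pM2l B0) -subr_ge0; have := q (mxdot B B) (- mxdot A B).
  by congr (0 <= _); ring.
have [->|AB] := eqVneq (mxdot A B) 0; first by rewrite expr0n/= mulr_ge0.
(* When [B.B = 0] the form is affine in [b]; this [b] gives it the value [-1], a contradiction. *)
have := q 1 (- (mxdot A A + 1) / (2 * mxdot A B)).
rewrite B0 mulr0 addr0 expr1n !mul1r.
suff -> : - (mxdot A A + 1) / (2 * mxdot A B) * 2 * mxdot A B = - (mxdot A A + 1).
  by lra.
by field.
Qed.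

Lemma measurable_frobenius d (T : measurableType d) (D : set T)
    (F : T -> 'M[R]_(m, n)) :
  (forall i j, measurable_fun D (fun x => F x i j)) ->
  measurable_fun D (fun x => frobenius (F x)).
Proof.
move=> mF; rewrite /frobenius /mxdot.
apply: (@measurableT_comp _ _ _ _ _ _ (@Num.sqrt R)).
  by apply: continuous_measurable_fun; exact: sqrt_continuous.
by do 2!(apply: measurable_sum => ?); exact: measurable_funM.
Qed.

End frobenius.

Section conjugate.
Context {R : realType}.
Implicit Types phi : R -> R.

Lemma fenchel_young phi (r s : R) : 0 <= s ->
  ((r * s)%:E <= (phi s)%:E + conjugate phi r)%E.
Proof.
move=> s0; rewrite -leeBlDl// -EFinB; apply: ereal_sup_ubound; exists s => //.
by rewrite /= in_itv/= s0.
Qed.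

Lemma conjugate_ge0 phi (r : R) : phi 0 <= 0 -> (0 <= conjugate phi r)%E.
Proof.
move=> phi0; apply: (@le_trans _ _ (r * 0 - phi 0)%:E).
  by rewrite lee_fin mulr0 sub0r oppr_ge0.
by apply: ereal_sup_ubound; exists 0 => //; rewrite /= in_itv/= lexx.
Qed.

(** A supremum of affine functions of [r] is lower semicontinuous: its strict superlevel sets are
    unions of open sets. *)
Lemma measurable_conjugate phi : measurable_fun [set: R] (conjugate phi).
Proof.
apply: lower_semicontinuous_measurable; apply/lower_semicontinuousP => a.
rewrite (_ : mkset _ =
    \bigcup_(s in `[0, +oo[) [set r | a < r * s - phi s]); last first.
  apply/seteqP; split=> r /=.
    by move=> /ereal_sup_gt[_ [s s0 <-]]; rewrite lte_fin; exists s.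
  move=> [s s0 /= ars]; apply: (@lt_le_trans _ _ (r * s - phi s)%:E).
    by rewrite lte_fin.
  by apply: ereal_sup_ubound; exists s.
apply: bigcup_open => s _.
apply: (@open_comp _ _ (fun r : R => r * s - phi s) [set y | a < y]).
  by move=> r _; apply: cvgB; [exact: mulrr_continuous|exact: cvg_cst].
exact: open_gt.
Qed.

(** The integral formula at [t = 0] runs over a single point. *)
Lemma N_function0 phi : N_function phi -> phi 0 = 0.
Proof.
move=> [_ _ _ [dphi [_ _ /(_ 0 (lexx _)) + _ _]]].
by rewrite set_itv1 integral_set1 => -[].
Qed.

End conjugate.

Lemma energy_weak_duality (R : realType) (d m N : nat) (Omega : set 'rV[R]_d)
    (T : 'I_N -> 'M[R]_(d.+1, d)) (V : set ('rV[R]_d -> 'rV[R]_m))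
    (f : ('rV[R]_d -> 'rV[R]_m) -> R) (phi : R -> R)
    (u : 'rV[R]_d -> 'rV[R]_m) (tau : 'rV[R]_d -> 'M[R]_(m, d)) :
  measurable Omega -> (forall t, 0 <= t -> 0 <= phi t) -> phi 0 = 0 ->
  L1_mx Omega tau -> neg_broken_div_eq Omega T V tau f -> V u ->
  (- energy Omega phi T f u <= dual_energy Omega phi tau)%E.
Proof.
move=> mO phi_ge0 phi0 L1tau divtau Vu.
have mtau i j : measurable_fun Omega (fun x => tau x i j).
  by have /measurable_int/measurable_EFinP := L1tau i j.
have phi_frob (A : 'M[R]_(m, d)) : 0 <= phi (frobenius A).
  exact/phi_ge0/sqrtr_ge0.
set a := integral (lebesgue_rV d) Omega
  (fun x => (phi (frobenius (broken_grad T u x)))%:E).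
have a0 : (0 <= a)%E by apply: integral_ge0 => x _; rewrite lee_fin.
have fa : ((f u)%:E <= a + dual_energy Omega phi tau)%E.
  (* The load becomes the integral of [tau] against the broken gradient of [u]; the conjugate term
     is the measurable summand. *)
  rewrite -divtau//; apply: le_lower_integralD => //.
  - by move=> x _; rewrite lee_fin.
  - by move=> x _; apply: conjugate_ge0; rewrite phi0.
  - apply: (measurableT_comp (measurable_conjugate phi)).
    exact: measurable_frobenius.
  move=> x _.
  apply: le_trans (fenchel_young phi (frobenius (tau x)) _ (sqrtr_ge0 _)).
  by rewrite lee_fin mxdot_CauchySchwarz.
(* As [f u] is finite, the negated energy is [f u - a]; for [a = +oo] it is [-oo]. *)
rewrite /energy -/a fin_num_oppeB// addeC; case: a a0 fa => [r| |]// _ fa.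
  by rewrite leeBlDl.
by rewrite leNye.
Qed.

Theorem theorem4p1 (R : realType) (d m : nat) (Omega : set 'rV[R]_d)
    (N : nat) (T : 'I_N -> 'M[R]_(d.+1, d))
    (Vh : set ('rV[R]_d -> 'rV[R]_m))
    (f : ('rV[R]_d -> 'rV[R]_m) -> R)
    (phi : R -> R)
    (uh : 'rV[R]_d -> 'rV[R]_m)
    (tau : 'rV[R]_d -> 'M[R]_(m, d)) :
  bounded_lipschitz_domain Omega ->
  regular_triangulation Omega T ->
  discrete_space Omega T Vh ->
  linear_on Vh f ->
  N_function phi ->
  Vh uh ->
  (forall wh, Vh wh ->
     (energy Omega phi T f uh <= energy Omega phi T f wh)%E) ->
  L1_mx Omega tau ->
  neg_broken_div_eq Omega T Vh tau f ->
  forall vh, Vh vh ->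
    (energy Omega phi T f vh - energy Omega phi T f uh <=
     energy Omega phi T f vh + dual_energy Omega phi tau)%E.
Proof.
move=> [_ oO _ _ _] _ _ _ Nphi Vu _ L1tau divtau vh Vvh.
(* Adding a common term preserves the order of extended reals even when that term is infinite. *)
apply: leeD2l; apply: (@energy_weak_duality _ _ _ _ _ _ Vh) => //.
- exact: open_measurable_rV.
- by case: Nphi.
- exact: N_function0.
Qed.
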